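(* Let $\gamma$ be an infinite limit ordinal and $n$ a positive integer. The maximum capture time of $\mathcal G_{\gamma+n}$ is $\gamma+n$, i.e. $\rho(\mathcal G_{\gamma+n})=\gamma+n$.
   Context: $\mathcal G_\gamma$ is the graph with vertex set $\gamma\times\gamma$ in which two distinct vertices $(\alpha_0,\beta_0),(\alpha_1,\beta_1)$ are adjacent iff $\alpha_0=\alpha_1=0$, or $\beta_0=\beta_1=0$, or ($\alpha_0=\beta_0$ and $\alpha_1=\beta_1$), or ($\alpha_0<\alpha_1$ and $\beta_0>\beta_1$), or ($\alpha_0>\alpha_1$ and $\beta_0<\beta_1$). $\mathcal G_{\gamma+n}$ is the graph with vertex set $(\gamma\times\gamma)\cup(\{-(n+1),\dots,-1\}\times\{0\})$ whose edges are all edges of $\mathcal G_\gamma$ together with the pairs $\{(-i,0),(-i+1,0)\}$ for $i=1,\dots,n+1$. $N[v]$ is the closed neighbourhood of $v$. Relations $\leq_\alpha$ on the vertex set for ordinals $\alpha$: $u\leq_0 v$ iff $u=v$; $u\leq_\alpha v$ if for every $x\in N[u]$ there is $y\in N[v]$ with $x\leq_\delta y$ for some $\delta<\alpha$. $\eta(v)$ is the minimum ordinal $\alpha$ with $u\leq_\alpha v$ for all vertices $u$, and $\rho(G)=\sup_v\eta(v)$ (the maximum capture time). *)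

(* Defs.v *)
From mathcomp Require Import all_boot.
From mathcomp Require Import boolp.

Set Implicit Arguments.
Unset Strict Implicit.
Unset Printing Implicit Defensive.

(* Ordinals are order types of well-ordered types: isomorphism classes of
   well-orders, represented as predicates on well-orders. *)

Record wellorder := WellOrder {
  wo_car :> Type;
  wo_lt : wo_car -> wo_car -> Prop;
  wo_wf : well_founded wo_lt;
  wo_trans : forall x y z, wo_lt x y -> wo_lt y z -> wo_lt x z;
  wo_total : forall x y, wo_lt x y \/ x = y \/ wo_lt y x
}.

Definition wo_mono (A B : wellorder) (f : A -> B) :=
  forall x y, wo_lt x y <-> wo_lt (f x) (f y).

Definition wo_iso (A B : wellorder) :=
  exists2 f : A -> B, wo_mono f & bijective f.

Definition wo_initial (A B : wellorder) :=
  exists b : B, exists2 f : A -> B, wo_mono f &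
    forall y, wo_lt y b <-> exists x, f x = y.

Record Ord := MkOrd {
  ord_class : wellorder -> Prop;
  ord_classP : exists A, ord_class = wo_iso A
}.

Definition order_type (A : wellorder) : Ord :=
  MkOrd (ex_intro _ A (erefl (wo_iso A))).

Definition ord_repr (a : Ord) : wellorder := sval (cid (ord_classP a)).

Definition ord_lt (a b : Ord) :=
  exists A B, [/\ ord_class a A, ord_class b B & wo_initial A B].

Definition ord_le (a b : Ord) := ord_lt a b \/ a = b.

Definition wo_empty : wellorder.
Proof. by apply: (@WellOrder void (fun _ _ => False)); case. Defined.

Section Succ.
Variable A : wellorder.

Definition wo_succ_lt (x y : option A) : Prop :=
  match x, y with
  | Some a, Some b => wo_lt a b
  | Some _, None => True
  | None, _ => False
  end.

Lemma wo_succ_wf : well_founded wo_succ_lt.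
Proof.
have accS a : Acc wo_succ_lt (Some a).
  elim/(well_founded_ind (@wo_wf A)): a => a IH.
  by apply: Acc_intro => -[b /IH|[]].
case=> [a|]; first exact: accS.
by apply: Acc_intro => -[b _|[]]; apply: accS.
Qed.

Lemma wo_succ_trans x y z : wo_succ_lt x y -> wo_succ_lt y z -> wo_succ_lt x z.
Proof. by case: x y z => [x|] [y|] [z|] //=; apply: wo_trans. Qed.

Lemma wo_succ_total x y : wo_succ_lt x y \/ x = y \/ wo_succ_lt y x.
Proof.
case: x y => [x|] [y|] /=; [|by left|by right; right|by right; left].
by case: (wo_total x y) => [|[->|]]; [left|right; left|right; right].
Qed.

Definition wo_succ : wellorder := WellOrder wo_succ_wf wo_succ_trans wo_succ_total.
End Succ.

Definition ord_zero : Ord := order_type wo_empty.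
Definition ord_succ (a : Ord) : Ord := order_type (wo_succ (ord_repr a)).
Definition ord_addn (a : Ord) (n : nat) : Ord := iter n ord_succ a.

(* A nonzero limit ordinal is automatically infinite. *)
Definition is_limit (a : Ord) :=
  a <> ord_zero /\ forall b, ord_lt b a -> ord_lt (ord_succ b) a.

Definition is_least (P : Ord -> Prop) (a : Ord) :=
  P a /\ forall b, P b -> ord_le a b.

Definition is_sup (T : Type) (f : T -> Ord) (a : Ord) :=
  is_least (fun b => forall t, ord_le (f t) b) a.

Record graph := Graph {
  vertex :> Type;
  adj : vertex -> vertex -> Prop;
  adj_sym : forall u v, adj u v -> adj v u;
  adj_irrefl : forall u, ~ adj u u
}.

Definition closed_nbhd (G : graph) (v x : G) := x = v \/ adj v x.

(* [capture_le a u v] is u <=_a v. Since u lies in N[u], the second clause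
   never applies when a is zero. *)
Inductive capture_le (G : graph) : Ord -> G -> G -> Prop :=
| capture_le_zero u : capture_le ord_zero u u
| capture_le_step a u v :
    (forall x, closed_nbhd u x ->
       exists2 y, closed_nbhd v y &
       exists2 d, ord_lt d a & capture_le d x y) ->
    capture_le a u v.

Definition is_capture_time (G : graph) (v : G) (a : Ord) :=
  is_least (fun b => forall u : G, capture_le b u v) a.

(* rho(G) = r; this includes the existence of eta(v) for every v. *)
Definition is_max_capture_time (G : graph) (r : Ord) :=
  exists2 eta : G -> Ord,
    (forall v, is_capture_time v (eta v)) & is_sup eta r.

Definition ord_below (c : Ord) := {a : Ord | ord_lt a c}.

Section CaptureGraph.
Variable c : Ord.
Implicit Types p q : ord_below c * ord_below c.

Definition grid_adj p q :=
  p <> q /\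
  let: (a0, b0) := (sval p.1, sval p.2) in
  let: (a1, b1) := (sval q.1, sval q.2) in
  (a0 = ord_zero /\ a1 = ord_zero) \/
  (b0 = ord_zero /\ b1 = ord_zero) \/
  (a0 = b0 /\ a1 = b1) \/
  (ord_lt a0 a1 /\ ord_lt b1 b0) \/
  (ord_lt a1 a0 /\ ord_lt b0 b1).

Lemma grid_adj_sym p q : grid_adj p q -> grid_adj q p.
Proof.
move=> [neq H]; split; first exact: nesym.
by case: H => [[]|[[]|[[]|[[]|[]]]]]; do ?[by left | right].
Qed.

Lemma grid_adj_irrefl p : ~ grid_adj p p.
Proof. by case. Qed.

Definition grid_graph : graph := Graph grid_adj_sym grid_adj_irrefl.

Variable n : nat.

(* [inr i] is the vertex (-i, 0). *)
Definition tailed_vertex : Type :=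
  (ord_below c * ord_below c) + {i : nat | 0 < i <= n.+1}.

(* [tail_step u v]: u = (-i, 0) and v = (-i + 1, 0) for some 1 <= i <= n+1. *)
Definition tail_step (u v : tailed_vertex) : Prop :=
  match u, v with
  | inr i, inr j => sval i = (sval j).+1
  | inr i, inl p => [/\ sval i = 1, sval p.1 = ord_zero & sval p.2 = ord_zero]
  | inl _, _ => False
  end.

Definition tailed_adj (u v : tailed_vertex) : Prop :=
  (exists p q, [/\ u = inl p, v = inl q & grid_adj p q]) \/
  tail_step u v \/ tail_step v u.

Lemma tailed_adj_sym u v : tailed_adj u v -> tailed_adj v u.
Proof.
case=> [[p [q [-> -> /grid_adj_sym pq]]]|]; first by left; exists q, p.
by case=> ?; right; [right|left].
Qed.

Lemma tailed_adj_irrefl u : ~ tailed_adj u u.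
Proof.
case=> [[p [q [-> [->]]]]|]; first exact: grid_adj_irrefl.
by case: u => [p|i] [] //= /n_Sn.
Qed.

Definition tailed_graph : graph := Graph tailed_adj_sym tailed_adj_irrefl.

End CaptureGraph.

(* Main.v *)
Require Import Defs.
From mathcomp Require Import all_boot.
From mathcomp Require Import boolp.

(** Upper bound.  From the origin a cop answers a robber at (a, b) with
    0 < a < b by moving to (0, b') with b < b': every escape from N[(0, b')]
    strictly decreases the first coordinate while staying above the diagonal.
    So every robber is caught from the origin in fewer than gamma steps, from
    (-(k+1), 0) in gamma + k steps, and from any grid vertex, which is at
    distance at most two from the origin, in gamma + 1 <= gamma + n steps.

    Lower bound.  If the cop is not on (a, b), then for each m with
    0 < m < min(a, b) the robber has a move out of the cop's closed
    neighbourhood to a vertex with both coordinates at least m, so min(a, b) is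
    a lower bound for the rank.  Against a cop at (-(k+1), 0) the robber waits
    at (1, 1) until the cop is about to reach the origin and then jumps
    arbitrarily high on the diagonal, which forces rank at least gamma + k. *)

Set Implicit Arguments.
Unset Strict Implicit.
Unset Printing Implicit Defensive.

Local Infix "<o" := ord_lt (at level 70).
Local Infix "<=o" := ord_le (at level 70).

(** * Comparison of well-orders *)

Lemma wo_lt_irr (A : wellorder) (x : A) : ~ wo_lt x x.
Proof.
elim/(well_founded_ind (@wo_wf A)): x => x IH xx.
exact: (IH _ xx xx).
Qed.

Lemma wo_least (A : wellorder) (P : A -> Prop) :
  (exists x, P x) -> exists2 x, P x & forall y, wo_lt y x -> ~ P y.
Proof.
case=> x; elim/(well_founded_ind (@wo_wf A)): x => x IH Px.
case: (pselect (exists2 y, wo_lt y x & P y)) => [[y yx Py]|nex].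
  exact: IH yx Py.
by exists x => // y yx Py; apply: nex; exists y.
Qed.

Lemma wo_lt_mono (A B : wellorder) (f : A -> B) :
  (forall x y, wo_lt x y -> wo_lt (f x) (f y)) -> wo_mono f.
Proof.
move=> fm x y; split; first exact: fm.
case: (wo_total x y) => [//|[->|/fm yx xy]]; first by move/wo_lt_irr.
by case: (wo_lt_irr (wo_trans xy yx)).
Qed.

Lemma wo_iso_refl A : wo_iso A A.
Proof. by exists id => //; exists id. Qed.

Lemma wo_iso_sym A B : wo_iso A B -> wo_iso B A.
Proof.
case=> f fm [g fK gK]; exists g; last by exists f.
by move=> x y; rewrite fm !gK.
Qed.

Lemma wo_iso_trans A B C : wo_iso A B -> wo_iso B C -> wo_iso A C.
Proof.
case=> f fm bf [g gm bg]; exists (g \o f); last exact: bij_comp.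
by move=> x y; rewrite fm gm.
Qed.

Lemma wo_initial_isol A A' B : wo_iso A' A -> wo_initial A B -> wo_initial A' B.
Proof.
case=> h hm [h' hK h'K] [b [f fm fb]]; exists b, (f \o h).
  by move=> x y; rewrite hm fm.
move=> y; rewrite fb; split=> [[x <-]|[x <-]]; last by exists (h x).
by exists (h' x); rewrite /= h'K.
Qed.

Lemma wo_initial_isor A B B' : wo_iso B B' -> wo_initial A B -> wo_initial A B'.
Proof.
case=> h hm [h' hK h'K] [b [f fm fb]]; exists (h b), (h \o f).
  by move=> x y; rewrite fm hm.
move=> y; rewrite -{1}(h'K y) -hm fb; split=> [[x fx]|[x <-]].
  by exists x; rewrite /= fx h'K.
by exists x; rewrite /= hK.
Qed.

Lemma wo_initial_trans A B C : wo_initial A B -> wo_initial B C -> wo_initial A C.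
Proof.
case=> b [f fm fb] [c [g gm gc]]; exists (g b), (g \o f).
  by move=> x y; rewrite fm gm.
move=> y; split=> [ygb|[x <-]]; last by rewrite -gm fb; exists x.
have /gc[z zy] : wo_lt y c by apply: wo_trans ygb _; apply/gc; exists b.
by move: ygb; rewrite -zy -gm => /fb[x <-]; exists x.
Qed.

(** An order-preserving self-map of a well-order never moves a point down, whereas an embedding onto
    the segment below b would send b below itself. *)
Lemma wo_initial_irr A : ~ wo_initial A A.
Proof.
case=> b [f fm fb].
have fge x : ~ wo_lt (f x) x.
  elim/(well_founded_ind (@wo_wf A)): x => x IH fx.
  exact: (IH _ fx ((fm _ _).1 fx)).
by apply: (fge b); apply/fb; exists b.
Qed.

(* [wo_match x y] holds when the initial segments below x and y are
   isomorphic; it is phrased as a bisimulation so that no isomorphism has to be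
   carried along. *)
Inductive wo_match (A B : wellorder) (x : A) (y : B) : Prop :=
| WoMatch of
    (forall x', wo_lt x' x -> exists2 y', wo_lt y' y & wo_match x' y') &
    (forall y', wo_lt y' y -> exists2 x', wo_lt x' x & wo_match x' y').

Lemma wo_match_sym (A B : wellorder) (x : A) (y : B) :
  wo_match x y -> wo_match y x.
Proof.
elim/(well_founded_ind (@wo_wf A)): x y => x IH y [xy yx].
split=> [y' /yx[x' lx m]|x' lx]; first by exists x' => //; apply: IH.
by have [y' ly m] := xy _ lx; exists y' => //; apply: IH.
Qed.

(** If y < y' both match x, then y also matches some x' < x, and x' in turn matches some z < y;
    uniqueness at x' gives y = z, which is absurd. *)
Lemma wo_match_fun (A B : wellorder) (x : A) (y1 y2 : B) :
  wo_match x y1 -> wo_match x y2 -> y1 = y2.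
Proof.
elim/(well_founded_ind (@wo_wf A)): x y1 y2 => x IH.
have nlt (y y' : B) : wo_match x y -> wo_match x y' -> ~ wo_lt y y'.
  move=> [xy _] [_ yx] /yx[x' lx m].
  have [z lz m'] := xy _ lx.
  by move: lz; rewrite (IH _ lx _ _ m m') => /wo_lt_irr.
move=> y1 y2 m1 m2.
by case: (wo_total y1 y2) => [/(nlt _ _ m1 m2)|[|/(nlt _ _ m2 m1)]].
Qed.

Lemma wo_match_lt (A B : wellorder) (x x' : A) (y y' : B) :
  wo_match x y -> wo_match x' y' -> wo_lt x x' -> wo_lt y y'.
Proof.
move=> m [xy _] /xy[z lz m'].
by rewrite (wo_match_fun m m').
Qed.

(** Matched elements form a downward closed set, so an unmatched one lies above all of them. *)
Lemma wo_match_unmatched_lt (A B : wellorder) (x a : A) (y : B) :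
  wo_match x y -> ~ (exists y' : B, wo_match a y') -> wo_lt x a.
Proof.
move=> m na; case: (wo_total x a) => [//|[e|ax]]; case: na.
  by exists y; rewrite -e.
by case: m => /(_ _ ax)[y' _ m] _; exists y'.
Qed.

Lemma wo_match_total_iso (A B : wellorder) :
  (forall x : A, exists y : B, wo_match x y) ->
  (forall y : B, exists x : A, wo_match x y) -> wo_iso A B.
Proof.
move=> /choice[f fP] /choice[g gP]; exists f.
  by apply: wo_lt_mono => x y; apply: wo_match_lt.
exists g => [x|y]; last exact: wo_match_fun (fP _) (gP _).
exact: wo_match_fun (wo_match_sym (gP (f x))) (wo_match_sym (fP x)).
Qed.

Lemma wo_match_total_initial (A B : wellorder) (b : B) :
  (forall x : A, exists y : B, wo_match x y) ->
  (forall y, wo_lt y b -> exists x : A, wo_match x y) ->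
  ~ (exists x : A, wo_match x b) -> wo_initial A B.
Proof.
move=> /choice[f fP] lb nb; exists b, f.
  by apply: wo_lt_mono => x y; apply: wo_match_lt.
move=> y; split=> [/lb[x m]|[x <-]].
  by exists x; apply: wo_match_fun (fP x) m.
apply: wo_match_unmatched_lt (wo_match_sym (fP x)) _ => -[x' /wo_match_sym m].
by apply: nb; exists x'.
Qed.

(** Matching is followed as far as it goes. Either one side is exhausted, and the least unmatched
    element of the other, if any, bounds the image, or both sides have a least unmatched element. *)
Lemma wo_trichotomy A B : wo_initial A B \/ wo_iso A B \/ wo_initial B A.
Proof.
have swap (C D : wellorder) (x : C) :
    (exists y : D, wo_match x y) <-> (exists y : D, wo_match y x).
  by split=> -[y m]; exists y; apply: wo_match_sym.
have least (C D : wellorder) : (forall x : C, exists y : D, wo_match x y) \/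
    exists2 x : C, ~ (exists y : D, wo_match x y) &
      forall x', wo_lt x' x -> exists y : D, wo_match x' y.
  case: (pselect (forall x : C, exists y : D, wo_match x y)); first by left.
  move=> /existsNP/wo_least[x nx lx]; right; exists x => // x' /lx.
  exact: contrapT.
have [tA|[a na la]] := least A B; have [tB|[b nb lb]] := least B A.
- right; left; apply: wo_match_total_iso tA _ => y; exact/swap.
- left; apply: (wo_match_total_initial (b := b)) tA _ _.
    by move=> y /lb /swap.
  by move/swap.
- right; right; apply: (wo_match_total_initial (b := a)) tB _ _.
    by move=> y /la /swap.
  by move/swap.
(* Two least unmatched elements would match each other, so this case is impossible. *)
- have na' := na; case: na; exists b; split=> [x lx|y ly].
    have [y m] := la _ lx; exists y => //.
    exact: wo_match_unmatched_lt (wo_match_sym m) nb.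
  have [x m] := lb _ ly; exists x; last exact: wo_match_sym.
  exact: wo_match_unmatched_lt (wo_match_sym m) na'.
Qed.

(** * Ordinals *)

(** Extensionality identifies the isomorphism classes of isomorphic well-orders and proof
    irrelevance the attached proofs, so ordinals can be compared by plain equality. *)
Lemma ord_classE a A : ord_class a A <-> a = order_type A.
Proof.
split=> [|->]; last exact: wo_iso_refl.
case: a => P Pc /= PA; rewrite /order_type.
have e : P = wo_iso A.
  case: Pc PA => A0 -> i; apply/funext => B; apply/propext; split.
    by apply: wo_iso_trans; apply: wo_iso_sym.
  exact: wo_iso_trans.
by subst P; congr MkOrd; apply: Prop_irrelevance.
Qed.

Lemma order_type_repr a : order_type (ord_repr a) = a.
Proof.
apply/esym/ord_classE; rewrite /ord_repr.
by case: cid => A /= ->; apply: wo_iso_refl.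
Qed.

Lemma order_type_eq A B : order_type A = order_type B <-> wo_iso A B.
Proof.
split=> [e|i]; last by apply/esym/ord_classE; apply: wo_iso_sym.
by apply/wo_iso_sym; change (ord_class (order_type B) A); apply/ord_classE.
Qed.

Lemma ord_lt_type A B : order_type A <o order_type B <-> wo_initial A B.
Proof.
split=> [[A' [B' [iA iB]]]|i]; last first.
  by exists A, B; split=> //; apply: wo_iso_refl.
by move/(wo_initial_isol iA); apply: wo_initial_isor; apply: wo_iso_sym.
Qed.

Lemma ord_ind_type (P : Ord -> Prop) : (forall A, P (order_type A)) -> forall a, P a.
Proof. by move=> PA a; rewrite -(order_type_repr a). Qed.

Lemma ord_lt_irr a : ~ a <o a.
Proof. by elim/ord_ind_type: a => A /ord_lt_type/wo_initial_irr. Qed.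

Lemma ord_lt_trans b a c : a <o b -> b <o c -> a <o c.
Proof.
elim/ord_ind_type: a => A; elim/ord_ind_type: b => B; elim/ord_ind_type: c => C.
rewrite !ord_lt_type; exact: wo_initial_trans.
Qed.

Lemma ord_lt_total a b : a <o b \/ a = b \/ b <o a.
Proof.
elim/ord_ind_type: a => A; elim/ord_ind_type: b => B.
rewrite !ord_lt_type order_type_eq; exact: wo_trichotomy.
Qed.

Lemma ord_lt_wf : well_founded ord_lt.
Proof.
(* Every B isomorphic to the segment below x has an accessible order type, by induction on x inside
   a fixed A. *)
have accI (A : wellorder) (x : A) (B : wellorder) (f : B -> A) : wo_mono f ->
    (forall y, wo_lt y x <-> exists z, f z = y) -> Acc ord_lt (order_type B).
  elim/(well_founded_ind (@wo_wf A)): x B f => x IH B f fm fx.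
  split; elim/ord_ind_type => C /ord_lt_type[b [g gm gb]].
  apply: (IH (f b) _ C (f \o g)); first by apply/fx; exists b.
    by move=> y z; rewrite gm fm.
  move=> y; split=> [yfb|[z <-]]; last by rewrite -fm gb; exists z.
  have /fx[z zy] : wo_lt y x by apply: wo_trans yfb _; apply/fx; exists b.
  by move: yfb; rewrite -zy -fm => /gb[w <-]; exists w.
elim/ord_ind_type => A; split; elim/ord_ind_type => B /ord_lt_type.
by case=> a [f fm fa]; apply: accI fm fa.
Qed.

Lemma ord_leNgt a b : a <=o b <-> ~ b <o a.
Proof.
split=> [[ab ba|->]|nba]; [|exact: ord_lt_irr|].
  exact: ord_lt_irr (ord_lt_trans ab ba).
by case: (ord_lt_total a b) => [|[|/nba//]]; [left|right].
Qed.

Lemma ord_lt_le_trans b a c : a <o b -> b <=o c -> a <o c.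
Proof. by move=> ab [|<-//]; apply: ord_lt_trans. Qed.

Lemma ord_le_lt_trans b a c : a <=o b -> b <o c -> a <o c.
Proof. by move=> [|->//]; apply: ord_lt_trans. Qed.

Lemma ord_le_refl a : a <=o a.
Proof. by right. Qed.

Lemma ord_le_trans b a c : a <=o b -> b <=o c -> a <=o c.
Proof. by move=> [ab bc|->//]; left; apply: ord_lt_le_trans bc. Qed.

Lemma ord_ltW a b : a <o b -> a <=o b.
Proof. by left. Qed.

Lemma ord_lt0 a : ~ a <o ord_zero.
Proof. by elim/ord_ind_type: a => A /ord_lt_type[[]]. Qed.

Lemma ord_le0 a : ord_zero <=o a.
Proof. by apply/ord_leNgt/ord_lt0. Qed.

Lemma ord_gt0 a : a <> ord_zero -> ord_zero <o a.
Proof. by case: (ord_le0 a) => // <-. Qed.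

Lemma ord_lt_succ a : a <o ord_succ a.
Proof.
rewrite -{1}(order_type_repr a); apply/ord_lt_type.
exists None, Some => // y; split=> [|[x <-]//].
by case: y => // y _; exists y.
Qed.

Lemma ord_ltS a b : a <o ord_succ b <-> a <=o b.
Proof.
split=> [|ab]; last exact: ord_le_lt_trans ab (ord_lt_succ b).
rewrite -{2}(order_type_repr b) /ord_succ; move: (ord_repr b) => B {b}.
elim/ord_ind_type: a => A /ord_lt_type[b [f fm fb]].
(* [None] lies below nothing, so it is not in the image, and f factors through [Some]. *)
have /choice[g gP] x : exists y, f x = Some y.
  case E: (f x) => [y|]; first by exists y.
  by have /fb : exists x, f x = None by exists x.
have gm : wo_mono g by move=> x y; rewrite fm !gP.
(* The bound of the image decides: [Some b] gives a proper initial segment of B, [None] gives all of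
   B. *)
case: b fb => [b|] fb.
  left; apply/ord_lt_type; exists b, g => // y.
  have := fb (Some y) => /= ->.
  by split=> -[x e]; exists x; move: e; rewrite gP; [case|move->].
right; apply/order_type_eq; exists g => //.
have /choice[h hP] y : exists x, f x = Some y by apply/fb.
exists h => [x|y]; last by move: (hP y); rewrite gP => -[].
by case: (wo_total (h (g x)) x) => [|[//|]]; rewrite fm hP gP => /wo_lt_irr.
Qed.

Lemma ord_leS a b : ord_succ a <=o b <-> a <o b.
Proof.
split=> [|ab]; first by apply: ord_lt_le_trans (ord_lt_succ a).
by apply/ord_leNgt => /ord_ltS/ord_leNgt.
Qed.

Lemma ord_lt_S a b : a <o b -> ord_succ a <o ord_succ b.
Proof. by move=> ab; apply/ord_ltS/ord_leS. Qed.

Lemma ord_addn_le a m n : m <= n -> ord_addn a m <=o ord_addn a n.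
Proof.
elim: n => [|n IH]; first by rewrite leqn0 => /eqP->; apply: ord_le_refl.
rewrite leq_eqVlt => /predU1P[->|/IH le]; first exact: ord_le_refl.
by apply: ord_le_trans le _; apply/ord_ltW/ord_lt_succ.
Qed.

Lemma ord_ex_least (P : Ord -> Prop) : (exists a, P a) -> exists a, is_least P a.
Proof.
case=> a; elim/(well_founded_ind ord_lt_wf): a => a IH Pa.
case: (pselect (exists2 b, b <o a & P b)) => [[b ba Pb]|nex].
  exact: IH ba Pb.
by exists a; split=> // b Pb; apply/ord_leNgt => ba; apply: nex; exists b.
Qed.

Lemma ord_ub2 c a b : a <o c -> b <o c -> exists2 m, m <o c & a <=o m /\ b <=o m.
Proof.
move=> ac bc; case: (ord_lt_total a b) => [ab|[e|ba]].
- by exists b => //; split; [left|right].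
- by exists b => //; split; right.
- by exists a => //; split; [right|left].
Qed.

Section Limit.
Variable c : Ord.
Hypothesis limc : is_limit c.

Lemma limit_gt0 : ord_zero <o c.
Proof. by case: limc => /ord_gt0. Qed.

Lemma limit_succ a : a <o c -> ord_succ a <o c.
Proof. by case: limc => _; apply. Qed.

Lemma limit_nat n : ord_addn ord_zero n <o c.
Proof. by elim: n => [|n /limit_succ//]; apply: limit_gt0. Qed.

End Limit.

(** * Capture relations *)

Section Capture.
Variable G : graph.
Implicit Types u v x y : G.

Lemma capture_le_inv a u v : capture_le a u v ->
  (a = ord_zero /\ u = v) \/
  forall x, closed_nbhd u x -> exists2 y, closed_nbhd v y &
    exists2 d, d <o a & capture_le d x y.
Proof. by case=> [w|b w w' H]; [left|right]. Qed.

Lemma capture_le_neq a u v : capture_le a u v -> u <> v ->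
  forall x, closed_nbhd u x -> exists2 y, closed_nbhd v y &
    exists2 d, d <o a & capture_le d x y.
Proof. by case/capture_le_inv=> [[_ ->]|]. Qed.

Lemma capture_leW a b u v : a <=o b -> capture_le a u v -> capture_le b u v.
Proof.
case=> [ab|-> //] /capture_le_inv[[a0 uv]|H]; apply: capture_le_step => x ux.
  exists x; first by rewrite -uv.
  by exists a => //; rewrite a0; apply: capture_le_zero.
have [y vy [d da xy]] := H x ux; exists y => //; exists d => //.
exact: ord_lt_trans ab.
Qed.

Lemma capture_le_refl a u : capture_le a u u.
Proof. exact: capture_leW (ord_le0 a) (capture_le_zero u). Qed.

Lemma capture_le_neq_gt0 a u v : capture_le a u v -> u <> v -> ord_zero <o a.
Proof.
move=> uv nuv; have [y _ [d da _]] := capture_le_neq uv nuv (or_introl (erefl u)).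
exact: ord_le_lt_trans (ord_le0 d) da.
Qed.

(** In [capture_le a u v] the robber stands at u, the cop at v, and the robber moves first. Here the
    robber has just moved to x, and the cop captures at once by stepping onto x. *)
Lemma capture_move_onto a v x : ord_zero <o a -> closed_nbhd v x ->
  exists2 y, closed_nbhd v y & exists2 d, d <o a & capture_le d x y.
Proof. by exists x => //; exists ord_zero => //; apply: capture_le_zero. Qed.

(** Intended for the reflection in the diagonal: it spares a second proof for robbers below the
    diagonal. *)
Lemma capture_le_aut (s : G -> G) a u v : involutive s ->
  (forall x y, closed_nbhd x y -> closed_nbhd (s x) (s y)) ->
  capture_le a u v -> capture_le a (s u) (s v).
Proof.
move=> sK sN; elim/(well_founded_ind ord_lt_wf): a u v => a IH u v.
case/capture_le_inv=> [[_ ->]|H]; first exact: capture_le_refl.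
apply: capture_le_step => x /sN; rewrite sK => /H[y vy [d da xy]].
exists (s y); first exact: sN.
by exists d => //; rewrite -(sK x); apply: IH.
Qed.

End Capture.

(** * The graph with a tail *)

Section Tailed.
Variables (c : Ord) (n : nat).
Hypothesis limc : is_limit c.
Let G : graph := tailed_graph c n.
Implicit Types p q r : ord_below c * ord_below c.

Local Notation abscissa p := (sval (fst p)).
Local Notation ordinate p := (sval (snd p)).

(** This is [grid_adj] without the demand that the vertices differ, which closed neighbourhoods make
    redundant. *)
Definition grid_rel p q :=
  (abscissa p = ord_zero /\ abscissa q = ord_zero) \/
  (ordinate p = ord_zero /\ ordinate q = ord_zero) \/
  (abscissa p = ordinate p /\ abscissa q = ordinate q) \/
  (abscissa p <o abscissa q /\ ordinate q <o ordinate p) \/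
  (abscissa q <o abscissa p /\ ordinate p <o ordinate q).

Lemma closed_nbhd_grid p q :
  closed_nbhd (inl p : G) (inl q) <-> p = q \/ grid_rel p q.
Proof.
split=> [[[->]|[[_ [_ [[<-] [<-] [_ pq]]]]|[]]]//|]; [by left|by right|].
case: (pselect (p = q)) => [->|npq]; first by left.
by case=> // pq; right; left; exists p, q.
Qed.

Lemma grid_ext p q :
  abscissa p = abscissa q -> ordinate p = ordinate q -> p = q.
Proof.
have inj (x y : ord_below c) : sval x = sval y -> x = y.
  case: x y => [x hx] [y hy] /= e; subst y.
  by congr exist; apply: Prop_irrelevance.
by case: p q => [p1 p2] [q1 q2] /= /inj-> /inj->.
Qed.

Lemma grid_point a b : a <o c -> b <o c ->
  exists2 p : ord_below c * ord_below c, abscissa p = a & ordinate p = b.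
Proof.
by move=> ha hb; exists (exist (ord_lt^~ c) a ha, exist (ord_lt^~ c) b hb).
Qed.

Definition swap_vertex (u : G) : G :=
  match u with inl p => inl (p.2, p.1) | inr i => inr i end.

Lemma swap_vertexK : involutive swap_vertex.
Proof. by case=> [[]|]. Qed.

Lemma grid_rel_swap p q : grid_rel p q -> grid_rel (p.2, p.1) (q.2, q.1).
Proof. rewrite /grid_rel /=; intuition. Qed.

Lemma closed_nbhd_swap u v :
  closed_nbhd u v -> closed_nbhd (swap_vertex u) (swap_vertex v).
Proof.
case: u v => [p|i] [q|j]; rewrite /swap_vertex //.
- by rewrite !closed_nbhd_grid => -[->|/grid_rel_swap]; [left|right].
- case=> // -[[? [? []]]//|[//|[? ? ?]]].
  by right; right; right; split.
- case=> // -[[? [? []]]//|[[? ? ?]|//]].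
  by right; right; left; split.
Qed.

(* [tail_at k v] says that v is the vertex (-k, 0). *)
Definition tail_at (k : nat) (v : G) : Prop :=
  match v with
  | inl p => [/\ k = 0, abscissa p = ord_zero & ordinate p = ord_zero]
  | inr i => sval i = k
  end.

Lemma tail_at_ex k : k <= n.+1 -> exists v, tail_at k v.
Proof.
case: k => [_|k lek].
  by have [p ? ?] := grid_point (limit_gt0 limc) (limit_gt0 limc); exists (inl p).
by exists (inr (exist (fun i => 0 < i <= n.+1) k.+1 lek)).
Qed.

Lemma tail_at_le k v : tail_at k v -> k <= n.+1.
Proof. by case: v => [p [->]|[i /= /andP[_ ?]] <-]. Qed.

Lemma tail_at_inj k u v : tail_at k u -> tail_at k v -> u = v.
Proof.
case: u v => [p|[i hi]] [q|[j hj]] /=.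
- by case=> _ p1 p2 [_ q1 q2]; congr inl; apply: grid_ext; rewrite ?p1 ?p2.
- by case=> -> _ _ j0; exfalso; move: (hj); rewrite j0.
- by move=> ik [k0 _ _]; exfalso; move: (hi); rewrite ik k0.
- by move=> ik jk; subst i j; congr inr; congr exist; apply: eq_irrelevance.
Qed.

Lemma tail_at_adj k u v : tail_at k u -> tail_at k.+1 v -> adj v u.
Proof.
case: u v => [p|i] [q|j] //=.
- by move=> _ [].
- by case=> -> ? ? ?; right; left; split.
- by move=> _ [].
- by move=> <- e; right; left.
Qed.

Lemma tail_at_nbhd k v x : tail_at k.+1 v -> closed_nbhd v x ->
  [\/ tail_at k x, tail_at k.+1 x | tail_at k.+2 x].
Proof.
case: v => [p []//|i /= ik] [->|]; first by constructor 2.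
case: x => [q|j] [[? [? []]]//|[]] //=.
- by case=> e ? ?; constructor 1; split=> //; move: ik; rewrite e => -[].
- by rewrite ik => -[<-]; constructor 1.
- by rewrite ik; constructor 3.
Qed.

(** One move from inside the tail leads again to the tail, counting the origin, and comes at most
    one step closer to the grid. *)
Lemma tail_at_nbhd_le k m v x : k <= m -> tail_at m.+1 v -> closed_nbhd v x ->
  exists2 j, k <= j & tail_at j x.
Proof.
move=> km /tail_at_nbhd/[apply] -[] tx; [exists m|exists m.+1|exists m.+2] => //.
  exact: leqW.
by do 2 apply: leqW.
Qed.

(** * Strategy of the cop *)

Lemma capture_above_diagonal p q :
  abscissa p <o ordinate p -> abscissa q = ord_zero ->
  ordinate p <o ordinate q ->
  capture_le (ord_succ (abscissa p)) (inl p : G) (inl q).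
Proof.
move: {-2}(abscissa p) (erefl (abscissa p)) => a.
elim/(well_founded_ind ord_lt_wf): a p q => a IH p q pa ab q0 pq.
have caught r := @capture_move_onto G (ord_succ a) (inl q) (inl r)
  (ord_le_lt_trans (ord_le0 a) (ord_lt_succ a)).
have b_gt0 : ord_zero <o ordinate p.
  exact: ord_le_lt_trans (ord_le0 _) ab.
apply: capture_le_step => -[r|i] px; last first.
  case: px => // -[[? [? []]]//|[//|[_ _ b0]]].
  by move: b_gt0; rewrite b0 => /ord_lt_irr.
case/closed_nbhd_grid: px => [<-|[[_ r0]|[[b0]|[[e]|[[pr rp]|[rp pr]]]]]].
- apply/caught/closed_nbhd_grid; right.
  case: (ord_le0 a) => [a_gt0|a0]; last by left; rewrite -pa -a0.
  by do 3 right; left; rewrite q0 -pa.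
- by apply/caught/closed_nbhd_grid; right; left.
- by move: b_gt0; rewrite b0 => /ord_lt_irr.
- by move: ab; rewrite pa e => /ord_lt_irr.
- apply/caught/closed_nbhd_grid; right; do 3 right; left; rewrite q0; split.
    exact: ord_le_lt_trans (ord_le0 _) pr.
  exact: ord_lt_trans pq.
(* The only escape is to the left and up. The cop moves along column 0 to one above the robber's new
   row; the limit hypothesis guarantees that this row exists. *)
- have [s s1 s2] := grid_point (limit_gt0 limc) (limit_succ limc (svalP r.2)).
  exists (inl s); first by apply/closed_nbhd_grid; right; left.
  exists (ord_succ (abscissa r)); first by apply: ord_lt_S; rewrite pa.
  apply: IH => //; rewrite ?s2; [by rewrite pa| |exact: ord_lt_succ].
  by apply: ord_lt_trans rp (ord_lt_trans _ pr); rewrite -pa.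
Qed.

Lemma capture_below_diagonal p q :
  ordinate p <o abscissa p -> ordinate q = ord_zero ->
  abscissa p <o abscissa q ->
  capture_le (ord_succ (ordinate p)) (inl p : G) (inl q).
Proof.
case: p q => [p1 p2] [q1 q2] /= ? ? ?.
have := capture_le_aut swap_vertexK closed_nbhd_swap
  (capture_above_diagonal (p := (p2, p1)) (q := (q2, q1)) _ _ _); exact.
Qed.

(** The cop stands between the robber and the grid and drives him to the end of the tail; m bounds
    the number of steps that the cop still has before that end. *)
Lemma capture_in_tail m k j u v : tail_at k v -> tail_at j u -> k <= j ->
  n.+1 <= k + m -> capture_le (ord_addn ord_zero m) u v.
Proof.
elim: m k j u v => [|m IH] k j u v kv ju kj len.
  have e : j = k.
    apply/eqP; rewrite eqn_leq kj andbT; apply: leq_trans (tail_at_le ju) _.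
    by rewrite -(addn0 k).
  rewrite e in ju; rewrite (tail_at_inj ju kv); exact: capture_le_refl.
move: kj; rewrite leq_eqVlt => /predU1P[e|]; first rewrite -e in ju.
  by rewrite (tail_at_inj ju kv); apply: capture_le_refl.
case: j ju => // j ju kj; apply: capture_le_step => x ux.
have [i ki ix] := tail_at_nbhd_le (k := k) (m := j) kj ju ux.
move: ki; rewrite leq_eqVlt => /predU1P[e|ki].
  rewrite -e in ix; exists v; first by left.
  exists (ord_addn ord_zero m); first exact: ord_lt_succ.
  by rewrite (tail_at_inj ix kv); apply: capture_le_refl.
have [w kw] := tail_at_ex (leq_trans ki (tail_at_le ix)).
exists w; first by right; apply/adj_sym/(tail_at_adj kv kw).
exists (ord_addn ord_zero m); first exact: ord_lt_succ.
by apply: IH kw ix ki _; rewrite addSnnS.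
Qed.

Lemma capture_from_origin (o u : G) : tail_at 0 o ->
  exists2 d, d <o c & capture_le d u o.
Proof.
case: o => [o [_ o1 o2]|[i hi] /= i0]; last by exfalso; move: (hi); rewrite i0.
have o0 : tail_at 0 (inl o) by split.
case: u => [p|i]; last first.
  exists (ord_addn ord_zero n.+1); first exact: limit_nat.
  exact: (capture_in_tail (k := 0) (j := sval i)).
case: (pselect (p = o)) => [->|npo].
  by exists ord_zero; [apply: limit_gt0|apply: capture_le_refl].
(* With m bounding both coordinates of p, rank m + 1 pays for the first exchange and for the chase
   after it. *)
have [m mc [pm1 pm2]] := ord_ub2 (svalP p.1) (svalP p.2).
exists (ord_succ m); first exact: limit_succ.
apply: capture_le_step => -[r|i] px; last first.
  case: npo; case: px => // -[[? [? []]]//|[//|[_ p1 p2]]].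
  by apply: grid_ext; rewrite ?o1 ?o2.
have caught := @capture_move_onto G (ord_succ m) (inl o) (inl r)
  (ord_le_lt_trans (ord_le0 m) (ord_lt_succ m)).
have nbhd_o s : abscissa s = ord_zero \/ ordinate s = ord_zero \/
    abscissa s = ordinate s -> closed_nbhd (inl o : G) (inl s).
  move=> h; apply/closed_nbhd_grid; right.
  by case: h => [h|[h|h]]; [left|right; left|right; right; left];
    rewrite ?o1 ?o2.
case: (pselect (abscissa r = ord_zero \/ ordinate r = ord_zero)) => [h|nr0].
  by apply/caught/nbhd_o; case: h; [left|right; left].
case: (ord_lt_total (abscissa r) (ordinate r)) => [lr|[er|lr]].
(* Off the axes and the diagonal, r is either p itself or obtained by lowering one coordinate and
   raising the other, so its smaller coordinate stays below m. *)
- have rm : abscissa r <o m.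
    case/closed_nbhd_grid: px => [e|[[_ r0]|[[_ r0]|[[_ e]|[[pr rp]|[rp pr]]]]]].
    + by apply: ord_lt_le_trans pm2; rewrite e.
    + by case: nr0; left.
    + by case: nr0; right.
    + by move: lr; rewrite e => /ord_lt_irr.
    + exact: ord_lt_trans lr (ord_lt_le_trans rp pm2).
    + exact: ord_lt_le_trans rp pm1.
  have [s s1 s2] := grid_point (limit_gt0 limc) (limit_succ limc (svalP r.2)).
  exists (inl s); first by apply: nbhd_o; left.
  exists (ord_succ (abscissa r)); first exact: ord_lt_S.
  by apply: capture_above_diagonal; rewrite ?s2 //; apply: ord_lt_succ.
- by apply/caught/nbhd_o; right; right.
- have rm : ordinate r <o m.
    case/closed_nbhd_grid: px => [e|[[_ r0]|[[_ r0]|[[_ e]|[[pr rp]|[rp pr]]]]]].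
    + by apply: ord_lt_le_trans pm1; rewrite e.
    + by case: nr0; left.
    + by case: nr0; right.
    + by move: lr; rewrite e => /ord_lt_irr.
    + exact: ord_lt_le_trans rp pm2.
    + exact: ord_lt_trans lr (ord_lt_le_trans rp pm1).
  have [s s1 s2] := grid_point (limit_succ limc (svalP r.1)) (limit_gt0 limc).
  exists (inl s); first by apply: nbhd_o; right; left.
  exists (ord_succ (ordinate r)); first exact: ord_lt_S.
  by apply: capture_below_diagonal; rewrite ?s1 //; apply: ord_lt_succ.
Qed.

Lemma capture_near_origin (o u v : G) : tail_at 0 o -> closed_nbhd v o ->
  capture_le c u v.
Proof.
move=> o0 vo; apply: capture_le_step => x _; exists o => //.
exact: capture_from_origin.
Qed.

(** From (-1, 0) the cop steps to the origin, where all ranks are below c, so rank c suffices there;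
    each of the k steps leading to (-1, 0) adds one. *)
Lemma capture_from_tail k (u v : G) : tail_at k.+1 v ->
  capture_le (ord_addn c k) u v.
Proof.
elim: k u v => [|k IH] u v kv.
  have [o o0] := tail_at_ex (leq0n _).
  by apply: (capture_near_origin _ o0); right; apply: tail_at_adj o0 kv.
have [w kw] := tail_at_ex (ltnW (tail_at_le kv)).
apply: capture_le_step => x _; exists w; first by right; apply: tail_at_adj kv.
by exists (ord_addn c k); [apply: ord_lt_succ|apply: IH].
Qed.

Lemma capture_from_grid (u : G) p : capture_le (ord_succ c) u (inl p).
Proof.
have [o o0] := tail_at_ex (leq0n _).
have near s : abscissa s = ord_zero -> closed_nbhd (inl s : G) o.
  case: o o0 => [o [_ o1 o2]|[i hi] /= i0 _]; last by exfalso; move: (hi); rewrite i0.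
  by move=> s0; apply/closed_nbhd_grid; right; left.
case: (ord_le0 (abscissa p)) => [p_gt0|p0]; last first.
  apply: capture_leW (ord_ltW (ord_lt_succ c)) _.
  by apply: capture_near_origin o0 _; apply: near.
(* The vertex in column 0 one row above p is adjacent both to p and to the origin. *)
have [s s1 s2] := grid_point (limit_gt0 limc) (limit_succ limc (svalP p.2)).
apply: capture_le_step => x _; exists (inl s).
  apply/closed_nbhd_grid; right; do 4 right; rewrite s1 s2.
  by split=> //; apply: ord_lt_succ.
exists c; first exact: ord_lt_succ.
by apply: capture_near_origin o0 _; apply: near.
Qed.

Lemma capture_upper (u v : G) : 0 < n -> capture_le (ord_addn c n) u v.
Proof.
move=> n_gt0; case: v => [p|i].
  (* Positivity of n enters here: a cop on the grid is only known to need rank at most c + 1. *)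
  exact: capture_leW (ord_addn_le c n_gt0) (capture_from_grid u p).
case/andP: (svalP i); case E: (sval i) => [//|k] _ lek.
by apply: capture_leW (ord_addn_le (m := k) (n := n) c lek) _; apply: capture_from_tail.
Qed.

(** * Strategy of the robber *)

(** The robber moves left, but not past the cop's column or column m, and high up. From the cop he
    is then weakly to the right and strictly above, off the axes and the diagonal, hence out of
    reach. *)
Lemma evade_column p q m : ord_zero <o m -> m <o abscissa p ->
  abscissa q <o abscissa p ->
  exists r, [/\ grid_rel p r, ~ closed_nbhd (inl q : G) (inl r),
               m <=o abscissa r & m <=o ordinate r].
Proof.
move=> m_gt0 mp qp.
have [a lap [ma qa]] := ord_ub2 mp qp.
(* The new row lies above the ordinate of p to make the move legal, above the abscissa of p to leave
   the diagonal, and above the ordinate of q to escape the cop. *)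
have [b' b'c [pb1 pb2]] := ord_ub2 (svalP p.1) (svalP p.2).
have [b'' b''c [bb qb]] := ord_ub2 b'c (svalP q.2).
have [r r1 r2] := grid_point (ord_lt_trans lap (svalP p.1)) (limit_succ limc b''c).
have a_gt0 := ord_lt_le_trans m_gt0 ma.
have ar : a <o ordinate r.
  rewrite r2; apply/ord_ltS; apply/ord_ltW.
  exact: ord_lt_le_trans lap (ord_le_trans pb1 bb).
have qr : ordinate q <o ordinate r by rewrite r2; apply/ord_ltS.
exists r; split; rewrite ?r1 //.
- do 4 right; rewrite r1 r2; split=> //.
  by apply/ord_ltS; apply: ord_le_trans pb2 bb.
- move/closed_nbhd_grid; rewrite /grid_rel r1.
  case=> [e|[[_ a0]|[[_ r0]|[[_ e]|[[_ rq]|[aq _]]]]]].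
  + by move: qr; rewrite e => /ord_lt_irr.
  + by move: a_gt0; rewrite a0 => /ord_lt_irr.
  + by move: qr; rewrite r0 => /ord_lt0.
  + by move: ar; rewrite e => /ord_lt_irr.
  + exact: ord_lt_irr (ord_lt_trans qr rq).
  + exact: ord_lt_irr (ord_lt_le_trans aq qa).
- exact: ord_le_trans ma (ord_ltW ar).
Qed.

Lemma evade_row p q m : ord_zero <o m -> m <o ordinate p ->
  ordinate q <o ordinate p ->
  exists r, [/\ grid_rel p r, ~ closed_nbhd (inl q : G) (inl r),
               m <=o abscissa r & m <=o ordinate r].
Proof.
case: p q => [p1 p2] [q1 q2] m_gt0 mp qp.
have [[r1 r2] [pr nqr m1 m2]] := evade_column (p := (p2, p1)) (q := (q2, q1)) m_gt0 mp qp.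
exists (r2, r1); split=> //; first exact: grid_rel_swap pr.
by move/closed_nbhd_swap.
Qed.

Lemma evade p (y : G) m : ord_zero <o m -> m <o abscissa p ->
  m <o ordinate p -> y <> inl p ->
  exists r, [/\ closed_nbhd (inl p : G) (inl r), ~ closed_nbhd y (inl r),
               m <=o abscissa r & m <=o ordinate r].
Proof.
move=> m_gt0 mp1 mp2 yp.
have relN r : grid_rel p r -> closed_nbhd (inl p : G) (inl r).
  by move=> pr; apply/closed_nbhd_grid; right.
case: (pselect (closed_nbhd y (inl p))) => [|nyp]; last first.
  by exists p; split=> //; [left|left|left].
have p1_gt0 := ord_lt_trans m_gt0 mp1.
have p2_gt0 := ord_lt_trans m_gt0 mp2.
case: y yp => [q|i] yp; last first.
  case=> // -[[? [? []]]//|[[_ p0 _]|//]].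
  by move: p1_gt0; rewrite p0 => /ord_lt_irr.
case/closed_nbhd_grid=> [e|]; first by case: yp; rewrite e.
case=> [[_ p0]|[[_ p0]|[[qd pd]|[[qp _]|[_ qp]]]]].
- by move: p1_gt0; rewrite p0 => /ord_lt_irr.
- by move: p2_gt0; rewrite p0 => /ord_lt_irr.
- case: (ord_lt_total (abscissa q) (abscissa p)) => [qp|[e|pq]].
  + have [r [/relN pr nr m1 m2]] := evade_column m_gt0 mp1 qp; by exists r.
  + by case: yp; congr inl; apply: grid_ext; rewrite -?qd -?pd.
  (* The cop sits further up the diagonal: slide along her row. *)
  + have [r r1 r2] := grid_point (ord_lt_trans mp1 (svalP p.1)) (svalP q.1).
    have mq := ord_lt_trans mp1 pq.
    exists r; split.
    * by apply: relN; do 4 right; rewrite r1 r2 -pd.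
    * move/closed_nbhd_grid; rewrite /grid_rel r1 r2 -qd.
      case=> [e|[[_ m0]|[[_ q0]|[[_ e]|[[_ qq]|[_ qq]]]]]];
        [..|exact: ord_lt_irr qq|exact: ord_lt_irr qq].
      - by move: mq; rewrite e r1 => /ord_lt_irr.
      - by move: m_gt0; rewrite m0 => /ord_lt_irr.
      - by move: mq; rewrite q0 => /ord_lt0.
      - by move: mq; rewrite e => /ord_lt_irr.
    * by rewrite r1; apply: ord_le_refl.
    * by rewrite r2; apply: ord_ltW.
(* In the last two cases one coordinate of the cop is strictly smaller than the robber's, and he
   evades through that coordinate. *)
- have [r [/relN pr nr m1 m2]] := evade_column m_gt0 mp1 qp; by exists r.
- have [r [/relN pr nr m1 m2]] := evade_row m_gt0 mp2 qp; by exists r.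
Qed.

(** If d < m, the robber evades with d itself as the level to keep. He stays uncaught with both
    coordinates at least d, so by induction the next rank is at least d, although it must be below
    d. *)
Lemma capture_grid_lower d p (y : G) m : capture_le d (inl p : G) y ->
  y <> inl p -> m <=o abscissa p -> m <=o ordinate p -> m <=o d.
Proof.
elim/(well_founded_ind ord_lt_wf): d p y m => d IH p y m py yp mp1 mp2.
apply/ord_leNgt => dm.
have d_gt0 := capture_le_neq_gt0 py (nesym yp).
have [r [pr nyr d1 d2]] := evade d_gt0 (ord_lt_le_trans dm mp1)
  (ord_lt_le_trans dm mp2) yp.
have [z yz [e ed rz]] := capture_le_neq py (nesym yp) pr.
suff /ord_leNgt : d <=o e by apply.
by apply: IH ed _ _ _ rz _ d1 d2 => zr; apply: nyr; rewrite -zr.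
Qed.

Lemma capture_tail_lower a k (v : G) p : abscissa p = ord_succ ord_zero ->
  ordinate p = ord_succ ord_zero -> tail_at k.+1 v ->
  capture_le a (inl p : G) v ->
  ord_addn c k <=o a.
Proof.
move=> p1 p2; elim/(well_founded_ind ord_lt_wf): a k v => a IH k v kv pv.
have nvp j (w : G) : tail_at j.+1 w -> forall q, w <> inl q.
  by move=> + q wq; rewrite wq => -[].
have npv := nesym (nvp _ _ kv p).
case: k kv => [|k] kv.
  (* The cop is at (-1, 0). Were the rank a below c, the robber would jump from (1, 1) to (a, a),
     and the rank left after the cop's answer would still be at least a. *)
  apply/ord_leNgt => ac; have a_gt0 := capture_le_neq_gt0 pv npv.
  have [q q1 q2] := grid_point ac ac.
  have pq : closed_nbhd (inl p : G) (inl q).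
    by apply/closed_nbhd_grid; right; right; right; left; rewrite p1 p2 q1 q2.
  have [y vy [d da qy]] := capture_le_neq pv npv pq.
  suff /ord_leNgt : a <=o d by apply.
  apply: (capture_grid_lower qy); rewrite ?q1 ?q2; [|exact: ord_le_refl..].
  move=> yq; rewrite yq in vy; case: (tail_at_nbhd kv vy) => -[] // _ q0 _.
  by move: a_gt0; rewrite -q1 q0 => /ord_lt_irr.
(* The cop is still at least two steps from the origin: the robber waits, and the cop's move gains
   at most one step. *)
have [y vy [d da py]] := capture_le_neq pv npv (or_introl (erefl _)).
apply/ord_leS; apply: ord_le_lt_trans (da).
have [[|j] kj jy] := tail_at_nbhd_le (leqnn k.+1) kv vy => //.
exact: ord_le_trans (ord_addn_le (m := k) (n := j) c kj) (IH _ da _ _ jy py).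
Qed.

End Tailed.

Theorem theorem15 (gamma : Ord) (n : nat) :
  is_limit gamma -> 0 < n ->
  is_max_capture_time (tailed_graph gamma n) (ord_addn gamma n).
Proof.
move=> limg n_gt0.
have upper := capture_upper (n := n) limg.
have /choice[eta etaP] (v : tailed_graph gamma n) :
    exists a, is_capture_time v a.
  apply: (ord_ex_least (P := fun b => forall u, capture_le b u v)).
  by exists (ord_addn gamma n) => u; apply: upper.
exists eta => //; split=> [v|b eta_b].
  by case: (etaP v) => _; apply=> u; apply: upper.
(* The bound is attained at the far end (-(n+1), 0) of the tail, against the robber at (1, 1). *)
have [v nv] := tail_at_ex limg (leqnn n.+1).
apply: ord_le_trans (eta_b v).
have one := limit_succ limg (limit_gt0 limg).
have [p p1 p2] := grid_point one one.
have [all_v _] := etaP v.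
exact: (capture_tail_lower limg p1 p2 nv (all_v (inl p))).
Qed.
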